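(* Let $f \colon \mathbb{R}^n \to \mathbb{R}$, $g \colon \mathbb{R}^n \to \mathbb{R}^m$, $h \colon \mathbb{R}^n \to \mathbb{R}^p$ be continuously differentiable, let $\rho > 0$, let $X := \{ x \in \mathbb{R}^n \mid g(x) \le 0, \ h(x) = 0, \ x \ge 0 \}$, and let $p^\rho(y) = \sum_{i=1}^n p_i^\rho(y_i)$ with each $p_i^\rho$ satisfying (P.1)--(P.3) stated in the context. Let $\delta = 0$, and let $\{(x^k,y^k)\}$ be an infinite sequence generated by the Exact Penalty Algorithm described in the context, with tolerances $\varepsilon_k$ and penalty parameters $\alpha_k$, such that $x^{k+1} \to_K x^*$ along a subsequence (infinite index set) $K \subseteq \mathbb{N}$. Then the following statements hold: (a) If $y_i^{k+1} \alpha_k \to_K 0$ for all $i \notin I_0(x^* )$, then $x^*$ is an AS-stationary point of the problem $\min_x f(x) + \rho\|x\|_0$ s.t. $x \in X$. (b) If $\varepsilon_k \alpha_k \to 0$, then $y_i^{k+1} \alpha_k \to_K 0$ for all $i \notin I_0(x^* )$.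
   Context: Notation: $\|x\|_0$ is the number of nonzero components of $x$; $I_0(x) := \{ i \mid x_i = 0\}$; $e_i$ is the $i$-th unit vector; $\mathbb{R}^n_+$ is the set of vectors with nonnegative entries; $L^{SP}(x,\lambda,\mu) := f(x) + \lambda^T g(x) + \mu^T h(x)$; $\to_K$ denotes convergence along indices $k \in K$, $k \to \infty$. Conditions on $p_i^\rho \colon \mathbb{R} \to \mathbb{R}$: (P.1) $p_i^\rho$ is convex and attains a unique minimum at some point $s_i^\rho > 0$; (P.2) $p_i^\rho(0) - p_i^\rho(s_i^\rho) = \rho$; (P.3) $p_i^\rho$ is continuously differentiable. AS-stationarity: $x^* \in X$ is AS-stationary if there exist sequences $\{z^k\} \subset \mathbb{R}^n$, $\{\lambda^k\} \subset \mathbb{R}^m_+$, $\{\mu^k\} \subset \mathbb{R}^p$ such that $z^k \to x^*$, $\nabla_{x_i} L^{SP}(z^k,\lambda^k,\mu^k) \to 0$ for all $i \notin I_0(x^* )$, and $\min\{-g_i(z^k), \lambda_i^k\} \to 0$ for all $i = 1,\dots,m$. Exact Penalty Algorithm: Step 1. Choose a nonnegative sequence $\varepsilon_k \searrow 0$ and parameters $\alpha_0 > 0$, $\beta > 1$, $\delta \ge 0$. Step 2. For $k = 0,1,2,\dots$ compute $(x^{k+1}, y^{k+1}, \lambda^{k+1}, \mu^{k+1}, \nu_x^{k+1}, \nu_y^{k+1}) \in \mathbb{R}^n_+ \times \mathbb{R}^n_+ \times \mathbb{R}^m_+ \times \mathbb{R}^p \times \mathbb{R}^n_+ \times \mathbb{R}^n_+$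 such that (i) $\|\nabla_x L^{SP}(x^{k+1},\lambda^{k+1},\mu^{k+1}) - \sum_{i=1}^n (\nu_x^{k+1})_i e_i + \alpha_k y^{k+1}\| \le \varepsilon_k$, (ii) $\|\nabla p^\rho(y^{k+1}) - \sum_{i=1}^n (\nu_y^{k+1})_i e_i + \alpha_k x^{k+1}\| \le \varepsilon_k$, (iii) $|\min\{-g_i(x^{k+1}), \lambda_i^{k+1}\}| \le \varepsilon_k$, $i=1,\dots,m$, (iv) $\|h(x^{k+1})\| \le \varepsilon_k$, (v) $\min\{x_i^{k+1}, (\nu_x^{k+1})_i\} \le \varepsilon_k$, $i=1,\dots,n$, (vi) $\min\{y_i^{k+1}, (\nu_y^{k+1})_i\} \le \varepsilon_k$, $i=1,\dots,n$. Step 3. If $\varepsilon_k \le \delta$ and $\sum_{i=1}^n x_i^{k+1} y_i^{k+1} \le \delta$, STOP. Otherwise set $\alpha_{k+1} = \alpha_k \beta$ and go to Step 2. *)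

(* Defs.v *)
From mathcomp Require Import all_boot all_order all_algebra.
From mathcomp Require Import all_classical all_reals all_analysis.

Set Implicit Arguments.
Unset Strict Implicit.
Unset Printing Implicit Defensive.

Import Order.TTheory GRing.Theory Num.Theory.
Import numFieldNormedType.Exports.

Local Open Scope classical_set_scope.
Local Open Scope ring_scope.

(* Vectors of R^n are row vectors 'rV[R]_n; their library norm `|x| is the
   sup norm, so the Euclidean norm is defined separately. *)
Definition dotp {R : realType} {n : nat} (u v : 'rV[R]_n) : R :=
  \sum_(i < n) u ord0 i * v ord0 i.

Definition enorm {R : realType} {n : nat} (u : 'rV[R]_n) : R :=
  Num.sqrt (dotp u u).

Definition nonneg {R : realType} {n : nat} (u : 'rV[R]_n) : Prop :=
  forall i, 0 <= u ord0 i.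

Definition unit_vec {R : realType} {n : nat} (i : 'I_n) : 'rV[R]_n :=
  delta_mx ord0 i.

Definition I0 {R : realType} {n : nat} (u : 'rV[R]_n) : set 'I_n :=
  [set i | u ord0 i = 0].

Definition grad {R : realType} {n : nat} (f : 'rV[R]_n -> R) (x : 'rV[R]_n) :
  'rV[R]_n := \row_(i < n) 'D_(unit_vec i) f x.

(* Only used with V finite-dimensional, where continuity of x |-> 'd F x v for
   every v is the same as continuity of x |-> 'd F x in operator norm. *)
Definition cont_diff {R : realType} {V W : normedModType R} (F : V -> W) : Prop :=
  (forall x, differentiable F x) /\ (forall v, continuous (fun x => 'd F x v)).

Definition cvg_along {T : topologicalType} (K : set nat) (u : nat -> T) (l : T) :
  Prop := u k @[k --> within K \oo] --> l.

Definition minimizer {R : realType} (p : R -> R) (s : R) : Prop :=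
  forall t, p s <= p t.

Record penalty_cond {R : realType} (rho : R) (p : R -> R) (s : R) : Prop := {
  pen_convex : convex_function (E := R^o) setT p;
  pen_s_gt0 : 0 < s;
  pen_min : minimizer p s;
  pen_min_unique : forall t, minimizer p t -> t = s;
  pen_drop : p 0 - p s = rho;
  pen_C1 : cont_diff p
}.

Definition penalty_sum {R : realType} {n : nat} (p : 'I_n -> R -> R)
    (y : 'rV[R]_n) : R :=
  \sum_(i < n) p i (y ord0 i).

Section SparseProblem.
Context {R : realType} {n m q : nat}.
Variables (f : 'rV[R]_n -> R) (g : 'rV[R]_n -> 'rV[R]_m)
  (h : 'rV[R]_n -> 'rV[R]_q).

Definition feasible : set 'rV[R]_n :=
  [set x | [/\ forall i, g x ord0 i <= 0, h x = 0 & nonneg x]].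

Definition lagrangianSP (lam : 'rV[R]_m) (mu : 'rV[R]_q) (x : 'rV[R]_n) : R :=
  f x + dotp lam (g x) + dotp mu (h x).

(* AS-stationarity for  min f(x) + rho * ||x||_0  s.t. x in feasible.
   The condition does not depend on rho: the l0-term only shows in that the
   gradient condition is restricted to the indices outside I0. *)
Definition AS_stationary (xs : 'rV[R]_n) : Prop :=
  feasible xs /\
  exists (z : nat -> 'rV[R]_n) (lam : nat -> 'rV[R]_m) (mu : nat -> 'rV[R]_q),
    [/\ forall k, nonneg (lam k),
        z k @[k --> \oo] --> xs,
        forall i, ~ I0 xs i ->
          grad (lagrangianSP (lam k) (mu k)) (z k) ord0 i @[k --> \oo] --> (0 : R)
      & forall i,
          Num.min (- g (z k) ord0 i) (lam k ord0 i) @[k --> \oo] --> (0 : R)].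

Record epa_iterate (p : 'I_n -> R -> R) (eps alpha : R)
    (x y : 'rV[R]_n) (lam : 'rV[R]_m) (mu : 'rV[R]_q) (nux nuy : 'rV[R]_n) :
    Prop := {
  it_x_ge0 : nonneg x;
  it_y_ge0 : nonneg y;
  it_lam_ge0 : nonneg lam;
  it_nux_ge0 : nonneg nux;
  it_nuy_ge0 : nonneg nuy;
  it_grad_x :
    enorm (grad (lagrangianSP lam mu) x
           - \sum_(i < n) nux ord0 i *: unit_vec i + alpha *: y) <= eps;
  it_grad_y :
    enorm (grad (penalty_sum p) y
           - \sum_(i < n) nuy ord0 i *: unit_vec i + alpha *: x) <= eps;
  it_g : forall i, `|Num.min (- g x ord0 i) (lam ord0 i)| <= eps;
  it_h : enorm (h x) <= eps;
  it_compl_x : forall i, Num.min (x ord0 i) (nux ord0 i) <= eps;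
  it_compl_y : forall i, Num.min (y ord0 i) (nuy ord0 i) <= eps
}.

Definition epa_stop (delta eps : R) (x y : 'rV[R]_n) : Prop :=
  eps <= delta /\ \sum_(i < n) x ord0 i * y ord0 i <= delta.

(* A run that never stops. Iterates are produced at the indices k.+1 only; the
   entries of the sequences at index 0 are unconstrained. *)
Record epa_infinite_run (p : 'I_n -> R -> R) (delta beta : R)
    (eps alpha : nat -> R) (x y : nat -> 'rV[R]_n) (lam : nat -> 'rV[R]_m)
    (mu : nat -> 'rV[R]_q) (nux nuy : nat -> 'rV[R]_n) : Prop := {
  run_eps_ge0 : forall k, 0 <= eps k;
  run_eps_noninc : nonincreasing_seq eps;
  run_eps_cvg : eps k @[k --> \oo] --> (0 : R);
  run_alpha0 : 0 < alpha 0%N;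
  run_beta : 1 < beta;
  run_delta : 0 <= delta;
  run_iterate : forall k,
    epa_iterate p (eps k) (alpha k) (x k.+1) (y k.+1) (lam k.+1) (mu k.+1)
      (nux k.+1) (nuy k.+1);
  run_continue : forall k, ~ epa_stop delta (eps k) (x k.+1) (y k.+1);
  run_alphaS : forall k, alpha k.+1 = alpha k * beta
}.

End SparseProblem.

(* Main.v *)
Require Import Defs.
From mathcomp Require Import all_boot all_order all_algebra.
From mathcomp Require Import all_classical all_reals all_analysis.
From mathcomp Require Import ring lra.

Set Implicit Arguments.
Unset Strict Implicit.

Import Order.TTheory GRing.Theory Num.Theory.
Import numFieldNormedType.Exports.

Local Open Scope classical_set_scope.
Local Open Scope ring_scope.

(** The two parts share one mechanism: a complementarity test
    [min (u, nu) <= eps] leaves only the alternatives [u <= eps] and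
    [nu <= eps], and for an index [i] with [xs_i > 0] one of them can be
    excluded far along the subsequence.

    In part (a) the test is the one on [x_i]. Since [x_i] tends to [xs_i > 0]
    while [eps] tends to 0, the multiplier of the constraint [x_i >= 0] satisfies
    [0 <= nu_i <= eps] eventually ([multiplier_eventually_le]). The [i]-th
    component of the x-residual then bounds the [i]-th component of the
    gradient of the Lagrangian by [2 eps + |alpha y_i|], which tends to 0 by
    hypothesis. The iterates along the subsequence, with their own multipliers
    for [g] and [h], are thus AS-stationarity witnesses. The limit is feasible
    because the bounds by [eps] on the violations of the constraints pass to
    the limit ([epa_limit_feasible]).

    In part (b) the test is the one on [y_i]. If its multiplier were at most
    [eps], the [i]-th component of the y-residual would give
    [p_i' (y_i) <= 2 eps - alpha x_i], which tends to minus infinity because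
    [alpha] grows geometrically and [x_i] stays above [xs_i / 2]. But
    convexity makes [p_i'] nondecreasing, so [p_i' (y_i) >= p_i' 0] as
    [y_i >= 0]. Hence [y_i <= eps] eventually
    ([large_slope_coord_le]), and [0 <= alpha y_i <= alpha eps] tends to 0. *)

(** * Convex functions of one real variable *)

(** The difference quotient of [p] at [a] in the direction [u - a] is at most
    [p u - p a] for every step in (0, 1], by convexity along the segment from
    [a] to [u]; the bound survives the limit as the step tends to 0. *)
Lemma convex_tangent_le (R : realType) (p : R -> R) (a u : R) :
  convex_function (E := R^o) setT p -> differentiable p a ->
  'D_1 p a * (u - a) <= p u - p a.
Proof.
move=> pcvx pdiff.
have -> : 'D_1 p a * (u - a) = 'D_(u - a) p a.
  rewrite !deriveE//.
  have -> : 'd p a (u - a) = 'd p a ((u - a) *: (1 : R^o)).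
    by rewrite /GRing.scale/= mulr1.
  by rewrite linearZ mulrC.
have dpa : (h^-1 *: ((p \o shift a) (h *: (u - a)) - p a) @[h --> 0^'+]
    --> 'D_(u - a) p a).
  exact/cvg_dnbhs_at_right/(@diff_derivable _ _ _ _ _ (u - a)).
apply: (cvgr_to_le dpa); near=> v.
have v0 : 0 < v by [].
have v1 : v <= 1 by near: v; apply: nbhs_right_le.
have cvx : p (v * (u - a) + a) <= v * p u + (1 - v) * p a.
  have -> : v * (u - a) + a = v * u + (1 - v) * a by ring.
  exact: (pcvx (Itv01 (ltW v0) v1) u a (in_setT _) (in_setT _)).
rewrite /GRing.scale/= mulrC ler_pdivrMr//; lra.
Unshelve. all: by end_near. Qed.

(** The tangent inequalities at [a] towards [b] and at [b] towards [a] add up to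
    [(p' b - p' a) (b - a) >= 0]. *)
Lemma convex_derive_homo (R : realType) (p : R -> R) :
  convex_function (E := R^o) setT p -> (forall t, differentiable p t) ->
  {homo (fun t => 'D_1 p t) : a b / a <= b}.
Proof.
move=> pcvx pdiff a b; rewrite le_eqVlt => /predU1P[->//|ab].
have := convex_tangent_le b pcvx (pdiff a).
have := convex_tangent_le a pcvx (pdiff b).
move=> tb ta; rewrite -(ler_pM2r (_ : 0 < b - a)) ?subr_gt0//; lra.
Qed.

(** * Coordinates of the stationarity residuals *)

(** The penalty is separable: moving along the [i]-th unit vector changes only
    the [i]-th summand, so the two difference quotients are equal already before
    the limit is taken. *)
Lemma grad_penalty_sum (R : realType) (n : nat) (p : 'I_n -> R -> R)
    (y : 'rV[R]_n) (i : 'I_n) :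
  grad (penalty_sum p) y ord0 i = 'D_1 (p i) (y ord0 i).
Proof.
rewrite mxE /derive.
set Q := (X in lim (fmap X _) = _); set Q' := (X in _ = lim (fmap X _)).
suff -> : Q = Q' by [].
apply/funext => h; rewrite /Q /Q' /=; congr (_ *: _).
rewrite /penalty_sum -sumrB (bigD1 i)//= big1 ?addr0.
  by rewrite !mxE !eqxx.
by move=> j ji; rewrite !mxE (negbTE ji) mulr0 add0r subrr.
Qed.

Lemma sum_unit_vecE (R : realType) (n : nat) (u : 'rV[R]_n) :
  \sum_(i < n) u ord0 i *: unit_vec i = u.
Proof. by rewrite -row_sum_delta. Qed.

Lemma coord_le_enorm (R : realType) (n : nat) (u : 'rV[R]_n) (i : 'I_n) :
  `|u ord0 i| <= enorm u.
Proof.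
rewrite /enorm -sqrtr_sqr ler_wsqrtr// /dotp (bigD1 i)//= -expr2 lerDl.
by apply: sumr_ge0 => j _; rewrite -expr2 sqr_ge0.
Qed.

Lemma enorm_residual_coord (R : realType) (n : nat) (G nu w : 'rV[R]_n)
    (a e : R) (i : 'I_n) :
  enorm (G - \sum_(j < n) nu ord0 j *: unit_vec j + a *: w) <= e ->
  `|G ord0 i - nu ord0 i + a * w ord0 i| <= e.
Proof.
by rewrite sum_unit_vecE => /(le_trans (coord_le_enorm _ i)); rewrite !mxE.
Qed.

Lemma residual_norm_le (R : realDomainType) (G nu w e : R) :
  0 <= nu -> nu <= e -> `|G - nu + w| <= e -> `|G| <= e + e + `|w|.
Proof.
move=> nu0 nue res; have -> : G = (G - nu + w) + nu - w by ring.
apply: le_trans (ler_normB _ _) _; rewrite lerD2r.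
by apply: le_trans (ler_normD _ _) _; rewrite lerD// ger0_norm.
Qed.

(** The core of part (b), for one coordinate of one iterate, with [w] in the
    place of [alpha x_i]: if the test held because of [nu <= e], then the
    residual would force the slope of [p] at [y] below its slope at 0. *)
Lemma large_slope_coord_le (R : realType) (p : R -> R) (y nu w e : R) :
  convex_function (E := R^o) setT p -> (forall t, differentiable p t) ->
  0 <= y -> `|'D_1 p y - nu + w| <= e -> Num.min y nu <= e ->
  2 * e - 'D_1 p 0 < w -> y <= e.
Proof.
move=> pcvx pdiff y0 res; rewrite ge_min => /orP[//|nue] w_large; exfalso.
have dp0 := convex_derive_homo pcvx pdiff y0.
by move: res dp0; rewrite ler_norml => /andP[_ ?] ?; lra.
Qed.

(** * Sequences *)

(** Bernoulli's inequality bounds the sequence below by one that grows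
    linearly. *)
Lemma geometric_cvgy (R : realType) (beta : R) (alpha : nat -> R) :
  0 < alpha 0%N -> 1 < beta -> (forall k, alpha k.+1 = alpha k * beta) ->
  alpha k @[k --> \oo] --> +oo.
Proof.
move=> a0 b1 aS.
have bern k : alpha 0%N * (1 + k%:R * (beta - 1)) <= alpha k.
  elim: k => [|k IH]; first lra.
  rewrite aS -natr1; apply: le_trans (ler_wpM2r _ IH); last lra.
  rewrite -mulrA ler_pM2l//.
  have : 0 <= k%:R * (beta - 1) ^+ 2 by rewrite mulr_ge0// sqr_ge0.
  lra.
apply/cvgryPge => M; near=> k; apply: le_trans (bern k).
have c0 : 0 < alpha 0%N * (beta - 1) by rewrite mulr_gt0//; lra.
have : M / (alpha 0%N * (beta - 1)) <= k%:R by near: k; exact: nbhs_infty_ger.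
rewrite ler_pdivrMr// => ?; lra.
Unshelve. all: by end_near. Qed.

(** Turns convergence along [K] into convergence of an ordinary sequence; the
    infinitude of [K] provides an index [phi k >= k] in [K] for every [k]. *)
Lemma infinite_set_cofinal (K : set nat) : infinite_set K ->
  exists phi : nat -> nat, phi k @[k --> \oo] --> within K \oo.
Proof.
move=> Kinf.
have next k : exists j, K j /\ (k <= j)%N.
  apply: contrapT => noj; apply: Kinf; apply: sub_finite_set (finite_II k).
  move=> j Kj /=; rewrite ltnNge; apply/negP => kj; apply: noj.
  by exists j.
have [phi phiP] := choice next.
exists phi => A [N _ NA]; exists N => // k /= Nk; have [Kphi kphi] := phiP k.
by apply: NA => //=; exact: leq_trans Nk kphi.
Qed.

Lemma cvg_coord (R : realType) (n : nat) (T : Type) (F : set_system T)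
    {FF : Filter F} (u : T -> 'rV[R]_n) (l : 'rV[R]_n) (i : 'I_n) :
  u t @[t --> F] --> l -> u t ord0 i @[t --> F] --> l ord0 i.
Proof.
move=> ul.
exact: (@cvg_comp _ _ _ u (fun v : 'rV[R]_n => v ord0 i) _ _ _ ul
  (@coord_continuous R 1 n ord0 i l)).
Qed.

(** * Limits of the iterates *)

Lemma epa_limit_feasible (R : realType) (n m q : nat)
    (g : 'rV[R]_n -> 'rV[R]_m) (h : 'rV[R]_n -> 'rV[R]_q)
    (z : nat -> 'rV[R]_n) (lam : nat -> 'rV[R]_m) (e : nat -> R)
    (xs : 'rV[R]_n) :
  continuous g -> continuous h ->
  z k @[k --> \oo] --> xs -> e k @[k --> \oo] --> (0 : R) ->
  (forall k, nonneg (z k)) ->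
  (forall k i, `|Num.min (- g (z k) ord0 i) (lam k ord0 i)| <= e k) ->
  (forall k, enorm (h (z k)) <= e k) ->
  feasible g h xs.
Proof.
move=> gcont hcont zxs e0 z0 gz hz.
have gzxs i : g (z k) ord0 i @[k --> \oo] --> g xs ord0 i.
  by apply: cvg_coord; apply: cvg_comp zxs _; exact: gcont.
have hzxs i : h (z k) ord0 i @[k --> \oo] --> h xs ord0 i.
  by apply: cvg_coord; apply: cvg_comp zxs _; exact: hcont.
split.
- move=> i; rewrite -subr_le0.
  apply: (@cvgr_to_le _ _ _ _ _ _ _ (cvgB (gzxs i) e0)); near=> k.
  have := gz k i; rewrite ler_norml => /andP[+ _].
  by rewrite le_min lerN2 => /andP[ge _]; rewrite /= subr_le0.
- apply/rowP => i; rewrite mxE.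
  apply: (cvg_unique _ (hzxs i)) => //; apply: norm_cvg0.
  apply: (squeeze_cvgr _ (cvg_cst 0) e0); near=> k.
  by rewrite normr_ge0/=; exact: le_trans (coord_le_enorm _ _) (hz k).
- move=> i; apply: (cvgr_to_ge (cvg_coord (i := i) zxs)); near=> k; exact: z0.
Unshelve. all: by end_near. Qed.

(** The alternative [x t <= e t] fails eventually, since [x] stays above [l / 2]
    and [e] drops below it. *)
Lemma multiplier_eventually_le (R : realType) (T : Type) (F : set_system T)
    {FF : Filter F} (x nu e : T -> R) (l : R) :
  x t @[t --> F] --> l -> 0 < l -> e t @[t --> F] --> (0 : R) ->
  (forall t, Num.min (x t) (nu t) <= e t) ->
  \forall t \near F, nu t <= e t.
Proof.
move=> xl l0 e0 compl; near=> t.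
have := compl t; rewrite ge_min => /orP[xe|//].
have : e t < l / 2 by near: t; apply: (cvgr_lt _ e0); lra.
have : l / 2 < x t by near: t; apply: (cvgr_gt _ xl); lra.
by move: xe; lra.
Unshelve. all: by end_near. Qed.

(** * Convergence to AS-stationary points *)

Theorem theorem6p8 (R : realType) (n m q : nat)
  (f : 'rV[R]_n -> R) (g : 'rV[R]_n -> 'rV[R]_m) (h : 'rV[R]_n -> 'rV[R]_q)
  (hf : cont_diff f) (hg : cont_diff g) (hh : cont_diff h)
  (rho : R) (hrho : 0 < rho)
  (p : 'I_n -> R -> R) (s : 'I_n -> R)
  (hp : forall i, penalty_cond rho (p i) (s i))
  (delta beta : R) (eps alpha : nat -> R)
  (x y : nat -> 'rV[R]_n) (lam : nat -> 'rV[R]_m) (mu : nat -> 'rV[R]_q)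
  (nux nuy : nat -> 'rV[R]_n)
  (hdelta : delta = 0)
  (hrun : epa_infinite_run f g h p delta beta eps alpha x y lam mu nux nuy)
  (K : set nat) (hK : infinite_set K)
  (xs : 'rV[R]_n) (hx : cvg_along K (fun k => x k.+1) xs) :
  ((forall i, ~ I0 xs i -> cvg_along K (fun k => y k.+1 ord0 i * alpha k) (0 : R)) ->
     AS_stationary f g h xs)
  /\
  (eps k * alpha k @[k --> \oo] --> (0 : R) ->
     forall i, ~ I0 xs i -> cvg_along K (fun k => y k.+1 ord0 i * alpha k) (0 : R)).
Proof.
have it k := run_iterate hrun k.
have e0 := run_eps_cvg hrun.
have [phi phicvg] := infinite_set_cofinal hK.
have phioo : phi k @[k --> \oo] --> \oo.
  exact: (cvg_trans phicvg (@cvg_within _ _ _ _)).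
have zxs : x (phi k).+1 @[k --> \oo] --> xs.
  exact: (cvg_comp phi (fun k => x k.+1) phicvg hx).
have ez : eps (phi k) @[k --> \oo] --> (0 : R).
  exact: (cvg_comp phi eps phioo e0).
have xs_feas : feasible g h xs.
  apply: (epa_limit_feasible (lam := fun k => lam (phi k).+1) _ _ zxs ez).
  - by move=> v; apply: differentiable_continuous; exact: hg.1.
  - by move=> v; apply: differentiable_continuous; exact: hh.1.
  - by move=> k; exact: it_x_ge0 (it _).
  - by move=> k; exact: it_g (it _).
  - by move=> k; exact: it_h (it _).
have xs_gt0 i : ~ I0 xs i -> 0 < xs ord0 i.
  move=> xsi; have [_ _ /(_ i)] := xs_feas.
  by rewrite le_eqVlt => /predU1P[xi0|//]; case: xsi.
split=> [ay0|ea0 i xsi].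
  split=> //; exists (fun k => x (phi k).+1), (fun k => lam (phi k).+1),
    (fun k => mu (phi k).+1); split=> //.
  - by move=> k; exact: it_lam_ge0 (it _).
  - move=> i xsi.
    have ayz : y (phi k).+1 ord0 i * alpha (phi k) @[k --> \oo] --> (0 : R).
      exact: (cvg_comp phi (fun k => y k.+1 ord0 i * alpha k) phicvg (ay0 i xsi)).
    have nu_le := multiplier_eventually_le (cvg_coord (i := i) zxs) (xs_gt0 i xsi)
      ez (fun k => it_compl_x (it (phi k)) i).
    apply: norm_cvg0.
    have bound0 : eps (phi k) + eps (phi k)
        + `|y (phi k).+1 ord0 i * alpha (phi k)| @[k --> \oo] --> (0 : R).
      rewrite -[X in _ --> X](addr0 (0 : R)) -[X in _ --> X + _](addr0 (0 : R)).
      rewrite -[X in _ --> _ + X](@normr0 _ R).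
      by apply: cvgD; [exact: cvgD | exact: cvg_norm].
    apply: (squeeze_cvgr _ (cvg_cst 0) bound0); near=> k.
    rewrite normr_ge0 /=.
    apply: (residual_norm_le (nu := nux (phi k).+1 ord0 i)).
    + exact: it_nux_ge0 (it _) i.
    + by near: k; exact: nu_le.
    + rewrite [y _ _ _ * _]mulrC.
      exact: enorm_residual_coord (it_grad_x (it (phi k))).
  - move=> i; apply: norm_cvg0; apply: (squeeze_cvgr _ (cvg_cst 0) ez).
    by near=> k; rewrite normr_ge0 /=; exact: it_g (it _) i.
have ay := geometric_cvgy (run_alpha0 hrun) (run_beta hrun) (run_alphaS hrun).
have a_gt0 k : 0 < alpha k.
  elim: k => [|k IH]; first exact: run_alpha0 hrun.
  by rewrite (run_alphaS hrun) mulr_gt0//; have := run_beta hrun; lra.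
have toK (u : nat -> R) : u k @[k --> \oo] --> (0 : R) -> cvg_along K u (0 : R).
  by move=> u0; apply: cvg_trans u0; apply: cvg_app; exact: cvg_within.
have half : xs ord0 i / 2 < xs ord0 i by have := xs_gt0 i xsi; lra.
apply: (squeeze_cvgr _ (cvg_cst 0) (toK _ ea0)); near=> k.
have y0 := it_y_ge0 (it k) i.
apply/andP; split; first exact: mulr_ge0 y0 (ltW (a_gt0 k)).
rewrite ler_pM2r//.
apply: (large_slope_coord_le (p := p i) (nu := nuy k.+1 ord0 i)
  (w := alpha k * x k.+1 ord0 i)) => //.
- exact: pen_convex (hp i).
- exact: (pen_C1 (hp i)).1.
- by rewrite -grad_penalty_sum; exact: enorm_residual_coord (it_grad_y (it k)).
- exact: it_compl_y (it k) i.
have e1 : eps k < 1.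
  by near: k; apply: cvg_within; apply: (cvgr_lt _ e0).
have xk : xs ord0 i / 2 < x k.+1 ord0 i.
  by near: k; apply: (cvgr_gt _ (cvg_coord (i := i) hx)).
(* with [eps < 1], the threshold [2 eps - p_i' 0] of [large_slope_coord_le] is
   below [2 - p_i' 0], which [alpha] times the lower bound on [x_i] exceeds *)
have : (2 - 'D_1 (p i) 0) / (xs ord0 i / 2) < alpha k.
  by near: k; apply: cvg_within; exact: cvgry_gt ay _.
rewrite ltr_pdivrMr; last by have := xs_gt0 i xsi; lra.
have : alpha k * (xs ord0 i / 2) < alpha k * x k.+1 ord0 i by rewrite ltr_pM2l.
lra.
Unshelve. all: by end_near. Qed.
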